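(* Let $n\ge2$ and let $L_2$ and $T_2$ denote the partial maxima BLUE and BLIE of $\theta_2$, and $\mathbf{m},\mathbf{S},\mathbf{D}$ as in the context. (i) There exists a constant $a=a_n(F)$ with $0<a<1$, depending only on $n$ and $F$ (not on $\theta_1,\theta_2$), such that $T_2=aL_2$; it is given by $a=\mathbf{m}'\mathbf{D}^{-1}\mathbf{m}=\mathbf{m}'\mathbf{S}^{-1}\mathbf{m}/(1+\mathbf{m}'\mathbf{S}^{-1}\mathbf{m})$. (ii) If either $n=2$ or $F$ is such that $\operatorname{Cov}[Z_i,Z_j]\le0$ for all $i\ne j$, $i,j=1,\dots,n-1$, then the partial maxima BLUE (and BLIE) of $\theta_2$ is non-negative.
   Context: $F$ is a known, parameter-free, non-degenerate distribution function on $\mathbb{R}$ with finite variance. For unknown $\theta_1\in\mathbb{R}$, $\theta_2>0$, $X_1^*,\dots,X_n^*$ are i.i.d. with distribution function $F((x-\theta_1)/\theta_2)$ and $X^*_{j:j}=\max\{X_1^*,\dots,X_j^*\}$; $X_1,\dots,X_n$ are i.i.d. from $F$ and $X_{j:j}=\max\{X_1,\dots,X_j\}$. Spacings: $Z_i=X_{i+1:i+1}-X_{i:i}$, $i=1,\dots,n-1$, $\mathbf{Z}=(Z_1,\dots,Z_{n-1})'$, $\mathbf{m}=\mathbb{E}[\mathbf{Z}]$, $\mathbf{S}$ the covariance matrix of $\mathbf{Z}$, $\mathbf{D}=\mathbb{E}[\mathbf{Z}\mathbf{Z}']$. Linear estimators are $\mathbf{c}'\mathbf{X}^*=\sum_i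 c_iX^*_{i:i}$ with constant $c_i$. BLUE of $\theta_2$: the linear estimator unbiased for $\theta_2$ for all $(\theta_1,\theta_2)$ with minimum variance. A linear statistic $L$ is invariant for $\theta_2$ if $L(b\mathbf{X}^*+a\mathbf{1})=bL(\mathbf{X}^* )$ for all $a\in\mathbb{R}$, $b>0$; BLIE of $\theta_2$: the invariant linear statistic minimizing $\mathbb{E}[L-\theta_2]^2$. *)

(* Defs.v *)
From HB Require Import structures.
From mathcomp Require Import all_boot all_order all_algebra.
From mathcomp Require Import all_classical all_reals all_analysis.
Set Implicit Arguments. Unset Strict Implicit. Unset Printing Implicit Defensive.
Import Order.TTheory GRing.Theory Num.Theory.
Local Open Scope classical_set_scope.
Local Open Scope ring_scope.

Section partial_maxima.
Context {d : measure_display} {T : measurableType d} {R : realType}.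
Variable P : probability T R.

(* partial maxima, 0-indexed: pmax X j = max{X 0, ..., X j}  (paper: X_{j+1:j+1}) *)
Fixpoint pmax (X : nat -> T -> R) (j : nat) : T -> R :=
  match j with
  | 0 => X 0%N
  | j'.+1 => fun w => Num.max (pmax X j' w) (X j'.+1 w)
  end.

Definition iid_from (n : nat) (X : nat -> {RV P >-> R}) (F : R -> R) : Prop :=
  (forall i, (i < n)%N -> forall r : R, cdf (X i) r = (F r)%:E) /\
  (forall B : 'I_n -> set R, (forall i, measurable (B i)) ->
     P (\bigcap_(i in [set: 'I_n]) (X i @^-1` B i)) =
     (\prod_(i < n) P (X i @^-1` B i))%E).

Definition nondegenerate_df (F : R -> R) : Prop :=
  ~ (exists c : R, forall x, F x = if x < c then 0 else 1).

(* The location-scale sample X*_i = theta1 + theta2 X_i has distribution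
   function F((x - theta1)/theta2); its partial maxima are theta1 + theta2 X_{j:j}.
   Linear statistic c' X* with coefficients c. *)
Definition linstat (n : nat) (X : nat -> T -> R) (c : 'I_n -> R) (th1 th2 : R)
  : T -> R :=
  fun w => \sum_(j < n) c j * (th1 + th2 * pmax X j w).

Definition unbiased2 n X (c : 'I_n -> R) : Prop :=
  forall th1 th2 : R, 0 < th2 -> ('E_P[linstat X c th1 th2] = th2%:E)%E.

Definition isBLUE2 n X (c : 'I_n -> R) : Prop :=
  unbiased2 X c /\
  forall c' : 'I_n -> R, unbiased2 X c' ->
    forall th1 th2 : R, 0 < th2 ->
      ('V_P[linstat X c th1 th2] <= 'V_P[linstat X c' th1 th2])%E.

Definition invariant2 n (c : 'I_n -> R) : Prop :=
  forall (x : 'I_n -> R) (a b : R), 0 < b ->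
    \sum_(j < n) c j * (b * x j + a) = b * \sum_(j < n) c j * x j.

Definition isBLIE2 n X (c : 'I_n -> R) : Prop :=
  invariant2 c /\
  forall c' : 'I_n -> R, invariant2 c' ->
    forall th1 th2 : R, 0 < th2 ->
      ('E_P[fun w => ((linstat X c th1 th2 w - th2) ^+ 2)%R] <=
       'E_P[fun w => ((linstat X c' th1 th2 w - th2) ^+ 2)%R])%E.

(* spacings Z_i = X_{i+1:i+1} - X_{i:i}, i = 1..n-1 (0-indexed here) *)
Definition spacing (n : nat) (X : nat -> T -> R) (i : 'I_n.-1) : T -> R :=
  fun w => pmax X i.+1 w - pmax X i w.

Definition mvec n X : 'cV[R]_(n.-1) := \col_i fine ('E_P[spacing X i])%E.
Definition Smat n X : 'M[R]_(n.-1) :=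
  \matrix_(i, j) fine (covariance P (spacing X i) (spacing X j)).
Definition Dmat n X : 'M[R]_(n.-1) :=
  \matrix_(i, j) fine ('E_P[fun w => (spacing X i w * spacing X j w)%R])%E.

End partial_maxima.

(* Main.v *)
Require Import Defs.
From HB Require Import structures.
From mathcomp Require Import all_boot all_order all_algebra.
From mathcomp Require Import all_classical all_reals all_analysis.
From mathcomp Require Import measurable_realfun ring lra.
Set Implicit Arguments. Unset Strict Implicit. Unset Printing Implicit Defensive.
Import Order.TTheory GRing.Theory Num.Theory.
Local Open Scope classical_set_scope.
Local Open Scope ring_scope.

(* A coefficient vector [c] summing to zero is the same as the vector [y] of its tail
   sums: by Abel summation [c' X* = theta2 * y' Z].  Unbiasedness means [y' m = 1] on
   top of [sum c = 0], and invariance is [sum c = 0].  The BLUE thus minimises [y' S y]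
   subject to [y' m = 1], attained only at [S^-1 m / (m' S^-1 m)], and the BLIE minimises
   [y' D y - 2 y' m], attained only at [D^-1 m].  As [D = S + m m'], Sherman-Morrison
   gives [D^-1 m = S^-1 m / (1 + m' S^-1 m)], hence the proportionality.

   [S] and [D] are positive definite because [y' Z] is never almost surely constant for
   [y <> 0]: choosing [r] with [0 < F r < 1], independence gives positive probability to
   each event "exactly [X_i] exceeds [r]", on which all spacings after the i-th
   observation vanish.  If the off-diagonal entries of [S] are non-positive, [S] is an
   M-matrix, so [S^-1 m >= 0] because [m >= 0]. *)

(** * Positive definite matrices and minimisation of quadratic forms *)

Section positive_definite.
Context {R : realFieldType} {k : nat}.
Implicit Types (A : 'M[R]_k) (x y m : 'cV[R]_k).

Definition dotmx x y : R := (x^T *m y) 0 0.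

Definition quadmx A x : R := dotmx x (A *m x).

Definition posdefmx A := A^T = A /\ forall x, x != 0 -> 0 < quadmx A x.

Lemma dotmxE x y : dotmx x y = \sum_i x i 0 * y i 0.
Proof. by rewrite /dotmx mxE; apply: eq_bigr => i _; rewrite mxE. Qed.

Lemma dotmxC x y : dotmx x y = dotmx y x.
Proof. by rewrite !dotmxE; apply: eq_bigr => i _; rewrite mulrC. Qed.

Lemma dotmxDr x y z : dotmx x (y + z) = dotmx x y + dotmx x z.
Proof. by rewrite /dotmx mulmxDr mxE. Qed.

Lemma dotmxZr a x y : dotmx x (a *: y) = a * dotmx x y.
Proof. by rewrite /dotmx -scalemxAr mxE. Qed.

Lemma dotmxDl x y z : dotmx (y + z) x = dotmx y x + dotmx z x.
Proof. by rewrite !(dotmxC _ x) dotmxDr. Qed.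

Lemma dotmxZl a x y : dotmx (a *: y) x = a * dotmx y x.
Proof. by rewrite !(dotmxC _ x) dotmxZr. Qed.

Lemma dotmx_trmul A x y : dotmx x (A *m y) = dotmx (A^T *m x) y.
Proof. by rewrite /dotmx trmx_mul trmxK mulmxA. Qed.

Lemma quadmxB A x y : A^T = A ->
  quadmx A (x - y) = quadmx A x - 2 * dotmx x (A *m y) + quadmx A y.
Proof.
move=> sA; rewrite /quadmx mulmxBr -!scaleN1r !dotmxDl !dotmxDr.
rewrite !dotmxZl !dotmxZr (dotmx_trmul A y x) sA [dotmx (A *m y) x]dotmxC.
by ring.
Qed.

Lemma quadmxZ A a x : quadmx A (a *: x) = a ^+ 2 * quadmx A x.
Proof. by rewrite /quadmx -scalemxAr dotmxZl dotmxZr mulrA expr2. Qed.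

Lemma quadmx_rank1 A m x : quadmx (A + m *m m^T) x = quadmx A x + dotmx x m ^+ 2.
Proof.
rewrite /quadmx mulmxDl dotmxDr -mulmxA [m^T *m x]mx11_scalar -/(dotmx m x).
by rewrite mul_mx_scalar dotmxZr (dotmxC m) expr2.
Qed.

Lemma quadmx0 A : quadmx A 0 = 0.
Proof. by rewrite /quadmx /dotmx trmx0 mul0mx mxE. Qed.

Lemma posdefmx_ge0 A x : posdefmx A -> 0 <= quadmx A x.
Proof.
case=> _ pA; have [->|/pA/ltW//] := eqVneq x 0.
by rewrite quadmx0.
Qed.

Lemma posdefmx_eq0 A x : posdefmx A -> quadmx A x <= 0 -> x = 0.
Proof. by case=> _ pA; apply: contraTeq => /pA; rewrite ltNge. Qed.

Lemma posdefmx_unit A : posdefmx A -> A \in unitmx.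
Proof.
move=> pA; rewrite -row_free_unit -kermx_eq0; apply/rowV0P => v /sub_kermxP vA.
rewrite -[v]trmxK (@posdefmx_eq0 A v^T) ?trmx0//.
by rewrite /quadmx /dotmx trmxK mulmxA vA mul0mx mxE.
Qed.

Lemma posdefmx_inv_gt0 A m : posdefmx A -> m != 0 -> 0 < dotmx m (invmx A *m m).
Proof.
move=> pA m0; have uA := posdefmx_unit pA.
have: invmx A *m m != 0.
  by apply: contra_neq m0 => h; rewrite -(mulKVmx uA m) h mulmx0.
by case: pA => _ /[apply]; rewrite /quadmx mulKVmx// dotmxC.
Qed.

(** Completing the square at [s^-1 *: A^-1 m]: on the hyperplane [dotmx x m = 1] the cross term is
    constant, so this point is the only minimiser. *)
Lemma quadmx_constrained A m x (s := dotmx m (invmx A *m m)) :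
  posdefmx A -> m != 0 -> dotmx x m = 1 ->
  quadmx A x = s^-1 + quadmx A (x - s^-1 *: (invmx A *m m)).
Proof.
move=> pA m0 xm; have uA := posdefmx_unit pA.
have s0 : s != 0 by rewrite gt_eqF// posdefmx_inv_gt0.
rewrite quadmxB; last by case: pA.
rewrite quadmxZ /quadmx -!scalemxAr !mulKVmx// dotmxZr xm (dotmxC _ m) -/s.
by field.
Qed.

Lemma quadmx_unconstrained A m x : posdefmx A ->
  quadmx A x - 2 * dotmx x m =
    quadmx A (x - invmx A *m m) - dotmx m (invmx A *m m).
Proof.
move=> pA; have uA := posdefmx_unit pA.
rewrite quadmxB; last by case: pA.
by rewrite [quadmx A (invmx A *m m)]/quadmx mulKVmx// [dotmx (_ *m _) m]dotmxC addrK.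
Qed.

(** Applying [A + m m^T] to [A^-1 m] gives [(1 + s) *: m], and [s >= 0] allows division by
    [1 + s]. *)
Lemma invmx_rank1 A m (s := dotmx m (invmx A *m m)) :
  posdefmx A -> A + m *m m^T \in unitmx ->
  invmx (A + m *m m^T) *m m = (1 + s)^-1 *: (invmx A *m m).
Proof.
move=> pA uD; have uA := posdefmx_unit pA.
have s0 : 0 <= s.
  rewrite /s; have [->|m0] := eqVneq m 0; last by rewrite ltW// posdefmx_inv_gt0.
  by rewrite /dotmx trmx0 mul0mx mxE.
have s1 : 1 + s != 0 by rewrite gt_eqF// ltr_wpDr.
apply: (can_inj (mulKmx uD)); rewrite mulKVmx// -scalemxAr mulmxDl mulKVmx//.
rewrite -mulmxA [m^T *m _]mx11_scalar -/(dotmx m _) -/s mul_mx_scalar.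
have -> : m + s *: m = (1 + s) *: m by rewrite scalerDl scale1r.
by rewrite scalerA mulVf// scale1r.
Qed.

(* Split [x = A^-1 m] as [p - q] with disjoint supports: off-diagonal signs give
   [q' A p <= 0], so [q' A q = q' A p - q' m <= 0] and [q = 0]. *)
Lemma posdefmx_inv_ge0 A m : posdefmx A -> (forall i j, i != j -> A i j <= 0) ->
  (forall i, 0 <= m i 0) -> forall i, 0 <= (invmx A *m m) i 0.
Proof.
move=> pA oA m0 i; have uA := posdefmx_unit pA.
set x := invmx A *m m.
pose p : 'cV[R]_k := \col_i Num.max (x i 0) 0.
pose q : 'cV[R]_k := \col_i Num.max (- x i 0) 0.
have xpq : x = p - q.
  apply/colP => j; rewrite !mxE.
  by rewrite !maxEle; case: ifP; case: ifP => *; lra.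
have q0 j : 0 <= q j 0 by rewrite mxE le_max lexx orbT.
have p0 j : 0 <= p j 0 by rewrite mxE le_max lexx orbT.
suff qE : q = 0 by rewrite xpq qE subr0.
apply: (posdefmx_eq0 pA).
have -> : quadmx A q = dotmx q (A *m p) - dotmx q m.
  rewrite -[m](mulKVmx uA) -/x xpq mulmxBr -[- (A *m q)]scaleN1r dotmxDr dotmxZr.
  by rewrite /quadmx; ring.
rewrite lerBlDr add0r (@le_trans _ _ 0)//; last first.
  by rewrite dotmxE sumr_ge0// => j _; rewrite mulr_ge0.
rewrite dotmxE sumr_le0// => j _; rewrite [(A *m p) j 0]mxE mulr_sumr sumr_le0// => l _.
have [<-|jl] := eqVneq j l.
  suff -> : q j 0 * (A j j * p j 0) = 0 by [].
  rewrite [q j 0]mxE [p j 0]mxE; have [xj|/ltW xj] := leP (x j 0) 0.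
    by rewrite !mulr0.
  by rewrite [Num.max (- _) _]max_r ?mul0r// oppr_le0.
by rewrite mulr_ge0_le0// mulr_le0_ge0// oA.
Qed.

End positive_definite.

(** * Summation by parts *)

Section summation_by_parts.
Context {R : comNzRingType} {k : nat}.

(** Each [x j] is [x 0] plus the increments before [j]; exchanging the sums collects at increment
    [i] the coefficients beyond [i]. *)
Lemma sum_abel (c : 'I_k.+1 -> R) (x : nat -> R) :
  \sum_j c j * x j = (\sum_j c j) * x 0%N +
    \sum_(i < k) (\sum_(j < k.+1 | (i < j)%N) c j) * (x i.+1 - x i).
Proof.
under [X in _ = _ + X]eq_bigr do rewrite mulr_suml.
rewrite (exchange_big_dep xpredT)//= mulr_suml -big_split/=.
apply: eq_bigr => j _; rewrite -mulr_sumr -mulrDr; congr (_ * _).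
have jk : (val j <= k)%N by rewrite -ltnS ltn_ord.
rewrite -(big_ord_widen k (fun i => x i.+1 - x i) jk).
rewrite -(big_mkord xpredT (fun i => x i.+1 - x i)) telescope_sumr//.
by rewrite addrC subrK.
Qed.

(** This is [y (j-1) - y j] with out-of-range terms read as 0; the indicators avoid treating both
    ends separately. It inverts the passage to tail sums. *)
Definition diff_coef (y : 'I_k -> R) (j : 'I_k.+1) : R :=
  \sum_i y i * ((val j == i.+1)%:R - (val j == i)%:R).

Lemma sum_diff_coef (y : 'I_k -> R) (x : nat -> R) :
  \sum_j diff_coef y j * x j = \sum_i y i * (x i.+1 - x i).
Proof.
rewrite /diff_coef; under eq_bigr do rewrite mulr_suml.
rewrite exchange_big/=; apply: eq_bigr => i _.
under eq_bigr do rewrite -mulrA mulrBl; rewrite -mulr_sumr; congr (_ * _).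
have pick (l : nat) : (l < k.+1)%N ->
    \sum_(j < k.+1) (val j == l)%:R * x j = x l.
  move=> lk; rewrite (bigD1 (Ordinal lk))//= eqxx mul1r big1 ?addr0// => j jl.
  by rewrite (_ : _ == _ = false) ?mul0r//; apply: contraNF jl => /eqP ?; apply/eqP/val_inj.
by rewrite sumrB !pick// ?ltnS// ltnW.
Qed.

Lemma sum_diff_coef0 (y : 'I_k -> R) : \sum_j diff_coef y j = 0.
Proof.
have := sum_diff_coef y (fun=> 1); rewrite subrr.
under eq_bigr do rewrite mulr1; move=> ->.
by rewrite big1// => i _; rewrite mulr0.
Qed.

End summation_by_parts.

(** * Moments of square-integrable variables *)

Section moments.
Context d (T : measurableType d) (R : realType) (P : probability T R).
Implicit Types (X Y : T -> R) (p : R).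

Lemma Lfun2_Lfun1 X : X \in Lfun P 2%:E -> X \in Lfun P 1.
Proof. by apply: Lfun_subset12; rewrite fin_num_measure. Qed.

Lemma ae_cst_of_variance0 X (r : R) : X \in Lfun P 2%:E ->
  ('E_P[fun w => ((X w - r) ^+ 2)%R] = 0)%E -> \forall w \ae P, X w = r.
Proof.
move=> X2; rewrite unlock => E0.
have mX : measurable_fun setT X by have := sub_Lfun_mfun X2; rewrite inE.
pose f : T -> R := fun w => (X w - r) ^+ 2.
have mf : measurable_fun setT (EFin \o f).
  apply/measurable_EFinP; apply: measurable_funX; exact: measurable_funB.
have := ae_eq_integral_abs P measurableT mf.
under eq_integral => w _ do rewrite gee0_abs ?lee_fin ?sqr_ge0//.
move=> [/(_ E0) h _]; apply: filterS h => w /(_ I)[] /eqP.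
by rewrite sqrf_eq0 subr_eq0 => /eqP.
Qed.

(** Since [max(x, y) = (x + y + |x - y|) / 2], closure under linear operations and absolute value
    suffices. *)
Lemma Lfun2_max X Y : X \in Lfun P 2%:E -> Y \in Lfun P 2%:E ->
  (fun w => Num.max (X w) (Y w)) \in Lfun P 2%:E.
Proof.
move=> X2 Y2.
have XY2 : X - Y \in Lfun P 2%:E by rewrite rpredB ?lee1n.
have N2 : ((fun w => `|X w - Y w|) : T -> R) \in Lfun P 2%:E.
  move: XY2; rewrite !inE => /andP[]; rewrite !inE/= => mf ff.
  apply/andP; split; rewrite inE/=; first exact: measurableT_comp.
  rewrite /finite_norm; under [X in ('N[_]__[X])%E]eq_fun => x do rewrite -abse_EFin.
  by rewrite Lnorm_abse.
have -> : (fun w => Num.max (X w) (Y w)) =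
    2^-1 \o* (X + Y + ((fun w => `|X w - Y w|) : T -> R)).
  by apply/funext => w /=; rewrite maxr_absE.
rewrite Lfun_scale ?ler1n//.
have XpY : X + Y \in Lfun P 2%:E by rewrite rpredD ?lee1n.
by rewrite rpredD ?lee1n.
Qed.

Lemma LfunZ2 (X : T -> R) (a : R) : X \in Lfun P 2%:E ->
  ((fun w => a * X w) : T -> R) \in Lfun P 2%:E.
Proof.
move=> X2; rewrite (_ : (fun w => _) = a \o* X); last first.
  by apply/funext => w /=; rewrite mulrC.
by rewrite Lfun_scale// ler1n.
Qed.

Lemma LfunZ1 (X : T -> R) (a : R) : X \in Lfun P 1 ->
  ((fun w => a * X w) : T -> R) \in Lfun P 1.
Proof.
move=> X2; rewrite (_ : (fun w => _) = a \o* X); last first.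
  by apply/funext => w /=; rewrite mulrC.
by rewrite Lfun_scale.
Qed.

Lemma expectationZ (X : T -> R) (a : R) : X \in Lfun P 1 ->
  ('E_P[fun w => (a * X w)%R] = a%:E * 'E_P[X])%E.
Proof.
move=> X1; rewrite -expectationZl//; congr expectation.
by apply/funext => w /=; rewrite mulrC.
Qed.

Lemma expectation_lincomb (I : finType) (f : I -> T -> R) (a : I -> R) :
  (forall i, f i \in Lfun P 1) ->
  ('E_P[fun w => (\sum_i a i * f i w)%R] = (\sum_i a i * fine 'E_P[f i])%:E)%E.
Proof.
move=> f1; pose g i : T -> R := fun w => a i * f i w.
transitivity ('E_P[\sum_(h <- [seq g i | i <- enum I]) h])%E.
  congr expectation; apply/funext => w.
  by rewrite big_map fct_sumE/= big_enum.
rewrite expectation_sum => [|_ /mapP[i _ ->]]; last exact: LfunZ1.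
rewrite big_map big_enum/= -sumEFin; apply: eq_bigr => i _.
by rewrite expectationZ// EFinM fineK// expectation_fin_num.
Qed.

Lemma expectation_affine_sqr (X : T -> R) (a b : R) : X \in Lfun P 2%:E ->
  ('E_P[fun w => ((a * X w - b) ^+ 2)%R] =
   (a ^+ 2 * fine 'E_P[fun w => (X w ^+ 2)%R] - 2 * a * b * fine 'E_P[X] + b ^+ 2)%:E)%E.
Proof.
move=> X2.
(* The expanded square is a linear combination of [X ^+ 2], [X] and 1. *)
pose f (i : 'I_3) : T -> R := if i == 0 then fun w => X w ^+ 2 else if i == 1 then X else cst 1.
pose c (i : 'I_3) : R := if i == 0 then a ^+ 2 else if i == 1 then - (2 * a * b) else b ^+ 2.
have f1 i : f i \in Lfun P 1.
  rewrite /f; case: ifP => _; first exact: (Lfun2_mul_Lfun1 X2 X2).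
  by case: ifP => _; [exact: Lfun2_Lfun1|exact: Lfun_cst].
transitivity ('E_P[fun w => (\sum_i c i * f i w)%R])%E.
  congr expectation; apply/funext => w; rewrite !big_ord_recl big_ord0 /c /f/=.
  by ring.
rewrite expectation_lincomb// !big_ord_recl big_ord0 /c /f/= expectation_cst/=.
by congr EFin; ring.
Qed.

End moments.

(** * Laws and their distribution functions *)

(** The intervals []a, b]] are stable under intersection and generate the Borel sets; their mass is
    a difference of two values of the cdf. *)
Lemma distribution_cdf d (T : measurableType d) (R : realType)
    (P : probability T R) (X Y : {RV P >-> R}) :
  cdf X =1 cdf Y -> forall A, measurable A -> distribution P X A = distribution P Y A.
Proof.
move=> XY A mA.
apply: (@measure_unique _ R _ (@ocitv R) (fun n => `]-n%:R, n%:R]%classic)) => //.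
- exact: ocitvI.
- by move=> n; exact: is_ocitv.
- exact: bigcup_itvT.
- move=> _ [[a b] _ <-] /=.
  have [ab|ba] := leP a b; last first.
    by rewrite set_itv_ge ?measure0// bnd_simp -leNgt ltW.
  have -> : `]a, b]%classic = `]-oo, b] `\` `]-oo, a].
    by rewrite -[RHS]setCK setCD setCitvl setUC -[LHS]setCK setCitv.
  rewrite !measureD//; [|by rewrite -ge0_fin_numE// fin_num_measure..].
  have sab : `]-oo, a] `<=` `]-oo, b] by apply: subset_itvl; rewrite bnd_simp.
  by rewrite !setIidr//; congr (_ - _)%E; exact: XY.
- by move=> n; rewrite -ge0_fin_numE// fin_num_measure.
Qed.

(** The p-norm is an integral against the law. This carries integrability of one observation over to
    the whole sample. *)
Lemma Lfun_cdf d (T : measurableType d) (R : realType)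
    (P : probability T R) (X Y : {RV P >-> R}) (p : R) :
  cdf X =1 cdf Y -> (X : T -> R) \in Lfun P p%:E -> (Y : T -> R) \in Lfun P p%:E.
Proof.
move=> XY /andP[_]; rewrite inE/= => fX.
apply/andP; split; rewrite inE//=.
move: fX; rewrite /finite_norm unlock.
suff -> : (\int[P]_x `|(X x)%:E| `^ p = \int[P]_x `|(Y x)%:E| `^ p)%E by [].
pose f (y : R) := (`|y| `^ p)%:E.
have mf : measurable_fun setT f.
  apply/measurable_EFinP/(measurableT_comp (measurable_powR _)).
  exact: normr_measurable.
have f0 y : (0 <= f y)%E by rewrite lee_fin powR_ge0.
transitivity (\int[distribution P X]_y f y)%E; first by rewrite ge0_integral_distribution.
transitivity (\int[distribution P Y]_y f y)%E; last by rewrite ge0_integral_distribution.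
by apply: eq_measure_integral => A mA _; exact: distribution_cdf.
Qed.

(** A cdf with values only in {0, 1} is, by monotonicity and its limits at infinity, a unit step at
    the infimum of the set where it equals 1. *)
Lemma nondegenerate_cdf d (T : measurableType d) (R : realType)
    (P : probability T R) (X : {RV P >-> R}) (F : R -> R) :
  (forall r, cdf X r = (F r)%:E) -> nondegenerate_df F ->
  exists r, 0 < F r < 1.
Proof.
move=> XF; apply: contra_notP => /forallNP F01.
have Fge0 r : 0 <= F r by rewrite -lee_fin -XF cdf_ge0.
have Fle1 r : F r <= 1 by rewrite -lee_fin -XF cdf_le1.
have FE r : F r = 0 \/ F r = 1.
  have := F01 r; have := Fge0 r; have := Fle1 r.
  rewrite le_eqVlt => /predU1P[->|->]; first by right.
  by rewrite le_eqVlt => /predU1P[<-|->]; [left|].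
have Fnd a b : a <= b -> F a <= F b.
  by move=> ab; rewrite -lee_fin -!XF; exact: cdf_nondecreasing.
pose A := [set r | F r = 1].
have A0 : A !=set0.
  have : \forall r \near +oo, (0 < cdf X r)%E.
    have := cvg_cdfy1 X => /(_ [set x | (0 < x)%E]); apply.
    by apply: open_nbhs_nbhs; split; [exact: open_ereal_gt_ereal|exact: lte01].
  move=> [M [_ /(_ (M + 1))]]; rewrite ltrDl ltr01 => /(_ isT) h.
  exists (M + 1); case: (FE (M + 1)) => // F0.
  by move: h; rewrite XF F0 ltxx.
have [m mlb] : has_lbound A.
  have : \forall r \near -oo, (cdf X r < 1)%E.
    have := cvg_cdfNy0 X => /(_ [set x | (x < 1)%E]); apply.
    by apply: open_nbhs_nbhs; split; [exact: open_ereal_lt_ereal|exact: lte01].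
  move=> [M [_ /(_ (M - 1))]]; rewrite gtrDl ltrN10 => /(_ isT) h.
  exists (M - 1) => r; rewrite /A/= => Fr.
  rewrite leNgt; apply/negP => /ltW/Fnd; rewrite Fr.
  by move: h; rewrite XF lte_fin ltNge => /negP.
have iA : has_inf A by split => //; exists m.
exists (inf A) => x.
case: ltP => [xA|Ax].
  case: (FE x) => // Fx; have := ge_inf iA.2 Fx.
  by rewrite leNgt xA.
have Fgt y : inf A < y -> F y = 1.
  move=> /inf_lt-/(_ A0)[z Az zy]; case: (FE y) => // Fy.
  by have := Fnd _ _ (ltW zy); rewrite Fy Az ler10.
(* At the jump itself the value 1 comes from right continuity. *)
move: Ax; rewrite le_eqVlt => /predU1P[<-|]; last exact: Fgt.
apply/EFin_inj; rewrite -XF.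
have h1 : cdf X r @[r --> (inf A)^'+] --> cdf X (inf A).
  exact: cdf_right_continuous.
apply: (cvg_unique _ h1) => //.
apply: cvg_near_cst; near=> r.
by rewrite XF Fgt//; near: r; exact: nbhs_right_gt.
Unshelve. all: by end_near. Qed.

(** * Mean, covariance and second moments of linear combinations *)

Section lincomb.
Context d (T : measurableType d) (R : realType) (P : probability T R) (k : nat).
Variable Z : 'I_k -> T -> R.
Hypothesis Z2 : forall i, Z i \in Lfun P 2%:E.

Definition lincomb (y : 'cV[R]_k) : T -> R := fun w => \sum_i y i 0 * Z i w.

Definition mean_mx : 'cV[R]_k := \col_i fine ('E_P[Z i])%E.
Definition cov_mx : 'M[R]_k := \matrix_(i, j) fine (covariance P (Z i) (Z j)).
Definition moment2_mx : 'M[R]_k :=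
  \matrix_(i, j) fine ('E_P[fun w => (Z i w * Z j w)%R])%E.

Lemma Lfun2_lincomb y : lincomb y \in Lfun P 2%:E.
Proof.
rewrite (_ : lincomb y = \sum_i ((fun w => y i 0 * Z i w) : T -> R)); last first.
  by apply/funext => w; rewrite fct_sumE.
elim/big_ind: _ => [|f g f2 g2|i _]; last exact: LfunZ2.
- by rewrite rpred0 ?lee1n.
- by rewrite rpredD ?lee1n.
Qed.

Lemma expectation_lincomb_mean y : ('E_P[lincomb y] = (dotmx y mean_mx)%:E)%E.
Proof.
rewrite expectation_lincomb; last by move=> i; exact: Lfun2_Lfun1.
by rewrite dotmxE; congr EFin; apply: eq_bigr => i _; rewrite mxE.
Qed.

Lemma expectation_lincomb_sqr y :
  ('E_P[fun w => (lincomb y w ^+ 2)%R] = (quadmx moment2_mx y)%:E)%E.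
Proof.
(* The square becomes one sum over pairs of indices, so linearity of expectation applies once. *)
transitivity ('E_P[fun w => (\sum_(p : 'I_k * 'I_k)
    (y p.1 0 * y p.2 0) * (Z p.1 w * Z p.2 w))%R])%E.
  congr expectation; apply/funext => w.
  rewrite expr2 /lincomb mulr_suml/=.
  under eq_bigr do rewrite mulr_sumr.
  by rewrite pair_bigA/=; apply: eq_bigr => p _; rewrite mulrACA.
rewrite (@expectation_lincomb _ _ _ P _ (fun p w => Z p.1 w * Z p.2 w)); last first.
  by move=> p; exact: Lfun2_mul_Lfun1.
congr EFin; rewrite /quadmx dotmxE.
transitivity (\sum_i \sum_j y i 0 * y j 0 * moment2_mx i j).
  by rewrite pair_bigA/=; apply: eq_bigr => p _; rewrite mxE.
apply: eq_bigr => i _; rewrite mxE mulr_sumr; apply: eq_bigr => j _.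
by rewrite -mulrA (mulrC (y j 0)).
Qed.

Lemma moment2_cov : moment2_mx = cov_mx + mean_mx *m mean_mx^T.
Proof.
apply/matrixP => i j; rewrite !mxE big_ord1 !mxE.
have Zij : Z i * Z j \in Lfun P 1 by exact: Lfun2_mul_Lfun1.
have Z1 l : Z l \in Lfun P 1 by exact: Lfun2_Lfun1.
rewrite covarianceE// fineB ?fin_numM ?expectation_fin_num//.
by rewrite fineM ?expectation_fin_num// subrK.
Qed.

Lemma variance_lincomb y : ('V_P[lincomb y] = (quadmx cov_mx y)%:E)%E.
Proof.
rewrite varianceE ?Lfun2_lincomb// expectation_lincomb_sqr expectation_lincomb_mean.
by rewrite moment2_cov quadmx_rank1 -EFin_expe -EFinB addrK.
Qed.

Lemma expectation_affine_lincomb_sqr y (a b : R) :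
  ('E_P[fun w => ((a * lincomb y w - b) ^+ 2)%R] =
   (a ^+ 2 * quadmx moment2_mx y - 2 * a * b * dotmx y mean_mx + b ^+ 2)%:E)%E.
Proof.
rewrite expectation_affine_sqr ?Lfun2_lincomb//.
by rewrite expectation_lincomb_sqr expectation_lincomb_mean.
Qed.

Lemma quadmx_moment2_ge0 y : 0 <= quadmx moment2_mx y.
Proof.
by rewrite -lee_fin -expectation_lincomb_sqr expectation_ge0// => w; exact: sqr_ge0.
Qed.

Lemma quadmx_cov_ge0 y : 0 <= quadmx cov_mx y.
Proof. by rewrite -lee_fin -variance_lincomb variance_ge0. Qed.

(** Linear independence of the [Z i] modulo constants and null sets. The value [r = 0] serves the
    second moments, [r] equal to the mean serves the covariance. *)
Hypothesis Zfree : forall y r, (\forall w \ae P, lincomb y w = r) -> y = 0.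

Lemma posdef_moment2 : posdefmx moment2_mx.
Proof.
split=> [|y]; first by apply/matrixP => i j; rewrite !mxE; congr fine;
  congr expectation; apply/funext => w; rewrite mulrC.
apply: contraNT; rewrite -leNgt => q0; apply/eqP/(Zfree (r := 0)).
apply: ae_cst_of_variance0; first exact: Lfun2_lincomb.
under [X in ('E__[X])%E]eq_fun do rewrite subr0.
by rewrite expectation_lincomb_sqr; congr EFin; apply/le_anti; rewrite q0 quadmx_moment2_ge0.
Qed.

Lemma posdef_cov : posdefmx cov_mx.
Proof.
split=> [|y]; first by apply/matrixP => i j; rewrite !mxE covarianceC.
apply: contraNT; rewrite -leNgt => q0; apply/eqP/(Zfree (r := dotmx y mean_mx)).
apply: ae_cst_of_variance0; first exact: Lfun2_lincomb.
(* The mean square deviation from the mean is read off the affine formula with [a = 1]; it reduces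
   to [quadmx cov_mx y], which is 0. *)
under [X in ('E__[X])%E]eq_fun do rewrite -[lincomb y _]mul1r.
rewrite expectation_affine_lincomb_sqr; congr EFin; rewrite moment2_cov quadmx_rank1.
have -> : quadmx cov_mx y = 0 by apply/le_anti; rewrite q0 quadmx_cov_ge0.
by ring.
Qed.

Hypothesis Z0 : forall i w, 0 <= Z i w.

Lemma mean_mx_ge0 i : 0 <= mean_mx i 0.
Proof. by rewrite mxE fine_ge0// expectation_ge0. Qed.

(** A non-negative [Z i0] with mean zero would vanish almost surely, which [Zfree] excludes for a
    unit vector. *)
Lemma mean_mx_neq0 (i0 : 'I_k) : mean_mx != 0.
Proof.
apply/eqP => /colP/(_ i0); rewrite !mxE => m0.
have Zi1 : Z i0 \in Lfun P 1 by exact: Lfun2_Lfun1.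
have EZ0 : ('E_P[Z i0] = 0)%E by rewrite -(fineK (expectation_fin_num Zi1)) m0.
have mZ : measurable_fun setT (EFin \o Z i0).
  by apply/measurable_EFinP; have := sub_Lfun_mfun Zi1; rewrite inE.
have [+ _] := ae_eq_integral_abs P measurableT mZ.
under eq_integral => w _ do rewrite gee0_abs ?lee_fin//.
move: EZ0; rewrite unlock => EZ0 /(_ EZ0) Zae.
have : delta_mx i0 0 = 0 :> 'cV[R]_k.
  apply: (Zfree (r := 0)); apply: filterS Zae => w /(_ I)[] Zw.
  rewrite /lincomb (bigD1 i0)//= Zw mulr0 add0r big1// => i /negPf ii0.
  by rewrite mxE ii0 mul0r.
by move=> /colP/(_ i0)/eqP; rewrite !mxE !eqxx oner_eq0.
Qed.

End lincomb.

(** * Partial maxima, spacings and their linear independence *)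

Section partial_maxima_facts.
Context d (T : measurableType d) (R : realType) (P : probability T R).
Implicit Types (X : nat -> T -> R).

Lemma pmax_gt X j (r : R) w :
  r < pmax X j w -> exists2 i, (i <= j)%N & r < X i w.
Proof.
elim: j => [|j IH] /=; first by exists 0%N.
rewrite lt_max => /orP[/IH[i ij ri]|rj]; first by exists i => //; exact: leqW.
by exists j.+1.
Qed.

Lemma le_pmax X i j w : (i <= j)%N -> X i w <= pmax X j w.
Proof.
elim: j => [|j IH] /=; first by rewrite leqn0 => /eqP ->.
rewrite leq_eqVlt ltnS le_max => /predU1P[->|/IH ->//]; first by rewrite lexx orbT.
Qed.

Lemma spacing_ge0 n X (i : 'I_n.-1) w : 0 <= spacing X i w.
Proof. by rewrite /spacing subr_ge0/= le_max lexx. Qed.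

Lemma Lfun2_pmax X n j : (forall i, (i < n)%N -> X i \in Lfun P 2%:E) ->
  (j < n)%N -> pmax X j \in Lfun P 2%:E.
Proof.
move=> X2; elim: j => [|j IH] jn /=; first exact: X2.
by apply: Lfun2_max; [exact/IH/ltnW|exact: X2].
Qed.

Lemma Lfun2_spacing X n : (forall i, (i < n)%N -> X i \in Lfun P 2%:E) ->
  forall i : 'I_n.-1, spacing X i \in Lfun P 2%:E.
Proof.
case: n => [|n] X2 i; first by case: i.
have i2 : pmax X i.+1 \in Lfun P 2%:E.
  by apply: Lfun2_pmax X2 _; rewrite ltnS ltn_ord.
have i1 : pmax X i \in Lfun P 2%:E.
  by apply: Lfun2_pmax X2 _; rewrite ltnW// ltnS ltn_ord.
by rewrite (_ : spacing X i = pmax X i.+1 - pmax X i)// rpredB ?lee1n.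
Qed.

(* If only [X_(i+1)] exceeds [r], the spacings after the [i]-th one vanish, while
   the [i]-th one is positive. *)
Lemma spacing_free n X (r : R) (y : 'cV[R]_n) (s : R) :
  (forall i : 'I_n.+1, exists2 w, lincomb (@spacing _ _ _ n.+1 X) y w = s &
     r < X i w /\ forall j : 'I_n.+1, j != i -> X j w <= r) ->
  y = 0.
Proof.
move=> H.
(* On such an event the partial maxima are at most [r] before [i] and frozen at [X i w] from [i]
   on. *)
have pmaxE (i : 'I_n.+1) w : r < X i w -> (forall j : 'I_n.+1, j != i -> X j w <= r) ->
    (forall j, (i <= j < n.+1)%N -> pmax X j w = X i w) /\
    (forall j, (j < i)%N -> pmax X j w <= r).
  move=> ri rj; split=> j.
    move=> /andP[ij jn]; apply/eqP; rewrite eq_le le_pmax// andbT leNgt.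
    apply/negP => /pmax_gt[l lj]; apply/negP; rewrite -leNgt.
    have ln : (l < n.+1)%N by apply: leq_ltn_trans jn.
    have [<-//|li] := eqVneq (Ordinal ln) i.
    by rewrite (le_trans (rj _ li))// ltW.
  move=> ji; rewrite leNgt; apply/negP => /pmax_gt[l lj]; apply/negP; rewrite -leNgt.
  have li : (l < i)%N by apply: leq_ltn_trans ji.
  apply: (rj (Ordinal (ltn_trans li (ltn_ord i)))).
  by rewrite -val_eqE/= ltn_eqF.
(* When the very first observation is the large one, every spacing vanishes. *)
have s0 : s = 0.
  have [w <- [rw rj]] := H ord0; rewrite /lincomb big1// => i _.
  have [E _] := pmaxE _ _ rw rj.
  by rewrite /spacing !E ?subrr ?mulr0//= ltnS// ltnW.
(* Spacing [i] ends at observation [i.+1], so that one is taken large: earlier coefficients vanish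
   by induction, later spacings by freezing, and only the term of index [i] remains. *)
apply/colP => -[i iN]; rewrite mxE; elim/ltn_ind: i iN => i IH iN.
have iN1 : (i.+1 < n.+1)%N by rewrite ltnS.
have [w + [rw rj]] := H (Ordinal iN1); have [E E'] := pmaxE _ _ rw rj.
rewrite s0 /lincomb (bigD1 (Ordinal iN))//= big1 ?addr0; last first.
  move=> j ji; have [ltji|] := ltnP j i.
    case: j {ji} ltji => j jn /= ltji.
    by rewrite IH// mul0r.
  rewrite leq_eqVlt eq_sym => /predU1P[ij|ij].
    by move: ji; rewrite -val_eqE/= ij eqxx.
  rewrite /spacing !E ?subrr ?mulr0//=; first by rewrite ij/= ltnS ltnW.
  by rewrite ltnS ltnW//= ltnS.
move=> /eqP; rewrite mulf_eq0 => /orP[/eqP//|].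
rewrite /spacing E ?leqnn// gt_eqF// subr_gt0.
by apply: le_lt_trans rw; exact: E'.
Qed.

(** Independence factors the probability into one [1 - F r] and otherwise [F r], all positive. *)
Lemma iid_single_exceedance n (X : nat -> {RV P >-> R}) (F : R -> R) (r : R) (i : 'I_n) :
  iid_from n X F -> 0 < F r < 1 ->
  (0 < P (\bigcap_(j in [set: 'I_n])
       (X j @^-1` (if j == i then `]r, +oo[%classic else `]-oo, r]%classic))))%E.
Proof.
move=> [XF ind] /andP[F0 F1].
rewrite (ind (fun j => if j == i then `]r, +oo[%classic else `]-oo, r]%classic)); last first.
  by move=> j; case: ifP => _; exact: measurable_itv.
rewrite (eq_bigr (fun j : 'I_n => (if j == i then 1 - F r else F r)%:E)); last first.
  move=> j _; have := XF j (ltn_ord j) r; case: ifP => _ //.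
  have := cdf_ccdf_1 (X j) r; rewrite /cdf /ccdf /distribution /pushforward => + FX.
  by rewrite FX EFinB => <-; rewrite addeAC subee// add0e.
rewrite prodEFin lte_fin prodr_gt0// => j _; case: ifP => _ //.
by rewrite subr_gt0.
Qed.

Lemma iid_spacing_free n (X : nat -> {RV P >-> R}) (F : R -> R) (y : 'cV[R]_n) (s : R) :
  iid_from n.+1 X F -> nondegenerate_df F ->
  (\forall w \ae P, lincomb (@spacing _ _ _ n.+1 (fun j => X j : T -> R)) y w = s) ->
  y = 0.
Proof.
move=> iidX ndF [N [mN N0 sN]].
have [r Fr] := nondegenerate_cdf (iidX.1 0%N isT) ndF.
apply: (@spacing_free n (fun j => X j : T -> R) r y s) => i.
have := iid_single_exceedance i iidX Fr.
set E := \bigcap_(j in _) _ => PE.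
have mE : measurable E.
  apply: fin_bigcap_measurable => // j _.
  by case: ifP => _; exact: measurable_funPTI.
(* An event of positive probability is not contained in the null set [N], so the almost sure
   identity holds at some point of it. *)
have [w [Ew Nw]] : exists w, E w /\ ~ N w.
  apply: contrapT => /forallNP h; move: PE; rewrite ltNge => /negP; apply.
  rewrite -N0; apply: le_measure; rewrite ?inE// => w Ew.
  by apply: contrapT => Nw; exact: (h w).
exists w; first by apply: contrapT => h; apply: Nw; exact: sN.
split=> [|j ji]; first by have := Ew i I; rewrite /= eqxx/= in_itv/= andbT.
by have := Ew j I; rewrite /= (negPf ji)/= in_itv.
Qed.

End partial_maxima_facts.

(** * Coefficients on maxima versus coefficients on spacings *)

Definition tail_coef (R : nmodType) k (c : 'I_k.+1 -> R) : 'cV[R]_k :=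
  \col_i \sum_(j < k.+1 | (i < j)%N) c j.

Lemma tail_diff_coef (R : comNzRingType) k (y : 'cV[R]_k) :
  tail_coef (diff_coef (fun i => y i 0)) = y.
Proof.
(* Both summation formulas are tested on a step sequence whose only non-zero increment sits at
   [i]. *)
apply/colP => i; pose x j : R := (i < j)%:R.
have dx l : x l.+1 - x l = (l == i)%:R.
  by rewrite /x ltnS leq_eqVlt eq_sym; case: ltngtP => //=; rewrite ?subrr ?subr0.
have pick (z : 'I_k -> R) : \sum_l z l * (x l.+1 - x l) = z i.
  under eq_bigr do rewrite dx.
  rewrite (bigD1 i)//= eqxx mulr1 big1 ?addr0// => l; rewrite -val_eqE => /negPf li.
  by rewrite li mulr0.
have := sum_abel (diff_coef (fun i => y i 0)) x.
rewrite sum_diff_coef sum_diff_coef0 mul0r add0r !pick => ->.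
by rewrite mxE.
Qed.

Lemma sum_tail_coef (R : comNzRingType) k (c : 'I_k.+1 -> R) (x : nat -> R) :
  \sum_j c j = 0 ->
  \sum_j c j * x j = \sum_(i < k) tail_coef c i 0 * (x i.+1 - x i).
Proof.
move=> c0; rewrite sum_abel c0 mul0r add0r.
by apply: eq_bigr => i _; rewrite mxE.
Qed.

Lemma invariant2P (R : realType) n (c : 'I_n -> R) : invariant2 c <-> \sum_j c j = 0.
Proof.
(* A unit shift of the zero sample isolates the sum of the coefficients. *)
split=> [/(_ (fun=> 0) 1 1 ltr01)|c0 x a b b0].
  under eq_bigr do rewrite mulr0 add0r mulr1.
  by move=> ->; rewrite big1 ?mulr0// => i _; exact: mulr0.
under eq_bigr do rewrite mulrDr; rewrite big_split/= -mulr_suml c0 mul0r addr0.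
by rewrite mulr_sumr; apply: eq_bigr => i _; rewrite mulrCA.
Qed.

(** * Characterisation of the BLUE and the BLIE *)

Section optimal_statistics.
Context d (T : measurableType d) (R : realType) (P : probability T R) (k : nat).
Variable X : nat -> T -> R.
Implicit Types (c : 'I_k.+1 -> R).

Local Notation Z := (@spacing _ _ _ k.+1 X : 'I_k -> T -> R).
Local Notation m := (mean_mx P Z).
Local Notation S := (cov_mx P Z).
Local Notation D := (moment2_mx P Z).
Local Notation s := (dotmx m (invmx S *m m)).

Hypothesis X2 : forall i, (i < k.+1)%N -> X i \in Lfun P 2%:E.
Hypothesis Zfree : forall y r, (\forall w \ae P, lincomb Z y w = r) -> y = 0.
Hypothesis k_gt0 : (0 < k)%N.

Let Z2 i : Z i \in Lfun P 2%:E.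
Proof. exact: Lfun2_spacing. Qed.

Lemma linstat_tail c (th1 th2 : R) : \sum_j c j = 0 ->
  linstat X c th1 th2 = fun w => th2 * lincomb Z (tail_coef c) w.
Proof.
move=> c0; apply/funext => w.
rewrite /linstat (sum_tail_coef (fun j => th1 + th2 * pmax X j w))// mulr_sumr.
by apply: eq_bigr => i _; rewrite /spacing; ring.
Qed.

Lemma unbiased2P c :
  unbiased2 P X c <-> \sum_j c j = 0 /\ dotmx (tail_coef c) m = 1.
Proof.
have E0 th1 th2 : \sum_j c j = 0 ->
    ('E_P[linstat X c th1 th2] = (th2 * dotmx (tail_coef c) m)%:E)%E.
  move=> c0; rewrite linstat_tail// expectationZ ?expectation_lincomb_mean//.
  by apply: Lfun2_Lfun1; exact: Lfun2_lincomb.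
split=> [uc|[c0 c1] th1 th2 _]; last by rewrite E0// c1 mulr1.
(* The parameters (0, 1) and (1, 1) give the same expectation, while the statistics differ by the
   constant [\sum_j c j]. *)
suff c0 : \sum_j c j = 0.
  by split=> //; have := uc 0 1 ltr01; rewrite E0// mul1r => -[].
have L1 : linstat X c 0 1 \in Lfun P 1.
  rewrite (_ : linstat _ _ _ _ = \sum_j ((fun w => c j * pmax X j w) : T -> R)).
    elim/big_ind: _ => [|f g f2 g2|i _]; [by rewrite rpred0|by rewrite rpredD|].
    exact/LfunZ1/Lfun2_Lfun1/(Lfun2_pmax X2)/ltn_ord.
  apply/funext => w; rewrite fct_sumE; apply: eq_bigr => j _.
  by rewrite add0r mul1r.
have := uc 1 1 ltr01.
rewrite (_ : linstat X c 1 1 = cst (\sum_j c j) \+ linstat X c 0 1); last first.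
  apply/funext => w; rewrite /linstat/= -big_split/=.
  by apply: eq_bigr => j _; ring.
rewrite expectationD ?Lfun_cst// expectation_cst uc// -EFinD => -[] /eqP.
by rewrite -subr_eq0 addrK => /eqP.
Qed.

(** The parameters enter only through the factor [th2 ^+ 2], so comparing variances at (0, 1)
    settles all parameters. *)
Lemma variance_linstat c (th1 th2 : R) : \sum_j c j = 0 ->
  ('V_P[linstat X c th1 th2] = (th2 ^+ 2 * quadmx S (tail_coef c))%:E)%E.
Proof.
move=> c0; rewrite linstat_tail//.
have -> : (fun w => th2 * lincomb Z (tail_coef c) w) = lincomb Z (th2 *: tail_coef c).
  apply/funext => w; rewrite /lincomb mulr_sumr; apply: eq_bigr => i _.
  by rewrite [in RHS]mxE mulrA.
by rewrite variance_lincomb// quadmxZ.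
Qed.

Lemma risk_linstat c (th1 th2 : R) : \sum_j c j = 0 ->
  ('E_P[fun w => ((linstat X c th1 th2 w - th2) ^+ 2)%R] =
   (th2 ^+ 2 * (quadmx D (tail_coef c) - 2 * dotmx (tail_coef c) m + 1))%:E)%E.
Proof.
move=> c0; rewrite linstat_tail// expectation_affine_lincomb_sqr//.
by congr EFin; ring.
Qed.

Let posS : posdefmx S. Proof. exact: posdef_cov. Qed.
Let posD : posdefmx D. Proof. exact: posdef_moment2. Qed.
Let m_neq0 : m != 0.
Proof. exact: mean_mx_neq0 Z2 Zfree (@spacing_ge0 _ _ _ k.+1 X) (Ordinal k_gt0). Qed.

(** A BLUE is compared with the statistic of tail vector [y0]: the excess in the completed square
    must vanish, which forces equality. The converse uses that the excess is non-negative. *)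
Lemma isBLUE2P c :
  isBLUE2 P X c <-> \sum_j c j = 0 /\ tail_coef c = s^-1 *: (invmx S *m m).
Proof.
set y0 := _ *: _.
have s_gt0 : 0 < s by exact: posdefmx_inv_gt0.
have y0m : dotmx y0 m = 1.
  by rewrite dotmxC dotmxZr mulVf// gt_eqF.
pose c0 := diff_coef (fun i => y0 i 0).
have uc0 : unbiased2 P X c0.
  by apply/unbiased2P; rewrite sum_diff_coef0 tail_diff_coef.
split=> [[/unbiased2P[c1 cm] /(_ _ uc0 0 1 ltr01) leV]|[c1 cy]].
  split=> //; apply/eqP; rewrite -subr_eq0; apply/eqP/(posdefmx_eq0 posS).
  move: leV; rewrite !variance_linstat ?sum_diff_coef0// tail_diff_coef.
  rewrite lee_fin expr1n !mul1r.
  rewrite (quadmx_constrained posS m_neq0 cm) (quadmx_constrained posS m_neq0 y0m).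
  by rewrite subrr quadmx0 addr0 gerDl.
split; first by apply/unbiased2P; rewrite cy.
move=> c' /unbiased2P[c'1 c'm] th1 th2 _.
rewrite !variance_linstat// lee_fin ler_wpM2l ?sqr_ge0//.
rewrite cy (quadmx_constrained posS m_neq0 c'm) (quadmx_constrained posS m_neq0 y0m).
by rewrite subrr quadmx0 addr0 lerDl posdefmx_ge0.
Qed.

Lemma isBLIE2P c :
  isBLIE2 P X c <-> \sum_j c j = 0 /\ tail_coef c = invmx D *m m.
Proof.
set y0 := _ *m _; pose c0 := diff_coef (fun i => y0 i 0).
have ic0 : invariant2 c0 by apply/invariant2P; exact: sum_diff_coef0.
split=> [[/invariant2P c1 /(_ _ ic0 0 1 ltr01)]|[c1 cy]].
  rewrite !risk_linstat ?sum_diff_coef0// tail_diff_coef.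
  rewrite lee_fin expr1n !mul1r lerD2r !(quadmx_unconstrained m _ posD) lerD2r.
  rewrite subrr quadmx0 => q0; split=> //.
  by apply/eqP; rewrite -subr_eq0; apply/eqP/(posdefmx_eq0 posD).
split; first exact/invariant2P.
move=> c' /invariant2P c'1 th1 th2 _.
rewrite !risk_linstat// lee_fin ler_wpM2l ?sqr_ge0// lerD2r.
rewrite !(quadmx_unconstrained m _ posD) lerD2r cy subrr quadmx0.
exact: posdefmx_ge0.
Qed.

End optimal_statistics.

(** * Proportionality and non-negativity of the optimal statistics *)

Theorem theorem4p1 (d : measure_display) (T : measurableType d) (R : realType)
  (P : probability T R) (F : R -> R) (n : nat) (X : nat -> {RV P >-> R}) :
  (2 <= n)%N ->
  iid_from n X F ->
  nondegenerate_df F ->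
  (X 0%N : T -> R) \in Lfun P 2 ->
  let Xs := fun i => (X i : T -> R) in
  let m := mvec P n Xs in
  let S := Smat P n Xs in
  let D := Dmat P n Xs in
  (* (i) *)
  (exists a : R,
     0 < a < 1 /\
     D \in unitmx /\ S \in unitmx /\
     a = (m^T *m invmx D *m m) 0 0 /\
     a = (m^T *m invmx S *m m) 0 0 / (1 + (m^T *m invmx S *m m) 0 0) /\
     (exists c : 'I_n -> R, isBLUE2 P Xs c) /\ (exists c : 'I_n -> R, isBLIE2 P Xs c) /\
     (forall L2 T2 : 'I_n -> R, isBLUE2 P Xs L2 -> isBLIE2 P Xs T2 ->
        forall x : 'I_n -> R,
          \sum_(j < n) T2 j * x j = a * \sum_(j < n) L2 j * x j)) /\
  (* (ii) *)
  ((n = 2%N \/ (forall i j : 'I_n.-1, i != j ->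
                  (covariance P (@spacing _ _ _ n Xs i) (@spacing _ _ _ n Xs j) <= 0)%E)) ->
   forall c : 'I_n -> R, isBLUE2 P Xs c \/ isBLIE2 P Xs c ->
   forall th1 th2 : R, 0 < th2 -> forall w : T, 0 <= linstat Xs c th1 th2 w).
Proof.
case: n => [|[|k]]// _ iidX ndF X02 Xs m S D.
pose Z : 'I_k.+1 -> T -> R := @spacing _ _ _ k.+2 Xs.
have X2 i : (i < k.+2)%N -> Xs i \in Lfun P 2%:E.
  move=> ik; apply: Lfun_cdf X02 => r.
  by rewrite (iidX.1 0%N)// (iidX.1 i).
have Z2 i : Z i \in Lfun P 2%:E by exact: Lfun2_spacing.
have Z0 i w : 0 <= Z i w by exact: spacing_ge0.
have Zfree y r : (\forall w \ae P, lincomb Z y w = r) -> y = 0.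
  exact: iid_spacing_free iidX ndF.
(* [S], [D] and [m] are convertible to [cov_mx], [moment2_mx] and [mean_mx] of the spacings, so the
   general results apply directly. *)
have posS : posdefmx S := posdef_cov Z2 Zfree.
have posD : posdefmx D := posdef_moment2 Z2 Zfree.
have m_neq0 : m != 0 := mean_mx_neq0 Z2 Zfree Z0 ord0.
have DE : D = S + m *m m^T := moment2_cov Z2.
have uS := posdefmx_unit posS; have uD := posdefmx_unit posD.
pose s := dotmx m (invmx S *m m).
have s_gt0 : 0 < s by exact: posdefmx_inv_gt0.
have BLUEP c : isBLUE2 P Xs c <->
    \sum_j c j = 0 /\ tail_coef c = s^-1 *: (invmx S *m m).
  exact: (isBLUE2P X2 Zfree).
have BLIEP c : isBLIE2 P Xs c <-> \sum_j c j = 0 /\ tail_coef c = invmx D *m m.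
  exact: (isBLIE2P X2 Zfree).
have invDE : invmx D *m m = (1 + s)^-1 *: (invmx S *m m).
  by rewrite DE invmx_rank1// -DE.
split.
  exists (s / (1 + s)).
  have sE : (m^T *m invmx S *m m) 0 0 = s by rewrite -mulmxA.
  split; first by rewrite divr_gt0 ?ltr_pdivrMr ?addr_gt0//= mul1r ltrDr.
  do 2!split=> //; split; first by rewrite -mulmxA invDE -scalemxAr mxE mulrC.
  split; first by rewrite sE.
  split.
    exists (diff_coef (fun i => (s^-1 *: (invmx S *m m)) i 0)).
    by apply/BLUEP; rewrite sum_diff_coef0 tail_diff_coef.
  split.
    exists (diff_coef (fun i => (invmx D *m m) i 0)).
    by apply/BLIEP; rewrite sum_diff_coef0 tail_diff_coef.
  move=> L2 T2 /BLUEP[L0 LE] /BLIEP[T0 TE] x.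
  (* Summation by parts needs a sequence on [nat]; [inord] extends [x], and its values out of range
     never enter. *)
  have sumE (c : 'I_k.+2 -> R) : \sum_(j < k.+2) c j * x j = \sum_j c j * x (inord j).
    by apply: eq_bigr => j _; rewrite inord_val.
  have T2E : tail_coef T2 = (s / (1 + s)) *: tail_coef L2.
    rewrite TE LE invDE scalerA; congr (_ *: _).
    by field; rewrite !gt_eqF// addr_gt0.
  rewrite !sumE !(sum_tail_coef (fun j => x (inord j)))// T2E mulr_sumr.
  by apply: eq_bigr => i _; rewrite [in LHS]mxE mulrA.
move=> cov0 c cB th1 th2 th2_gt0 w.
(* For [n = 2] the matrix is 1 by 1 and has no off-diagonal entry. *)
have offS i j : i != j -> S i j <= 0.
  case: cov0 => [[k0]|cov0 ij].
    have ord0E (l : 'I_k.+1) : l = 0 :> nat.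
      by apply/eqP; rewrite -leqn0 -k0 -ltnS ltn_ord.
    by rewrite -val_eqE/= !ord0E.
  by rewrite mxE fine_le0// cov0.
have x_ge0 i : 0 <= (invmx S *m m) i 0.
  by apply: posdefmx_inv_ge0 => // j; exact: mean_mx_ge0.
(* Both optimal tail vectors are positive multiples of [S^-1 m], so either statistic is [th2] times
   a non-negative combination of spacings, at every sample point. *)
have [c0 c_ge0] : \sum_j c j = 0 /\ forall i, 0 <= tail_coef c i 0.
  case: cB => [/BLUEP[c0 ->]|/BLIEP[c0 ->]]; split=> // i.
    by rewrite mxE mulr_ge0// invr_ge0 ltW.
  by rewrite invDE mxE mulr_ge0// invr_ge0 ltW// addr_gt0.
rewrite linstat_tail//; apply: mulr_ge0; first exact: ltW.
by apply: sumr_ge0 => i _; rewrite mulr_ge0// spacing_ge0.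
Qed.
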